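(* Let $n\ge 1$, let $I$ be a non-empty real interval, $J\supset I$ an interval, let $\omega_1,\dots,\omega_n$ be $C^\infty$ real functions on $J$ that do not vanish on $I$, and let $a\in J$ be fixed. Let $$\phi(t)=\left(L_{\omega_1}^{[a,t]},L_{\omega_1\omega_2}^{[a,t]},\dots,L_{\omega_1\omega_2\cdots\omega_n}^{[a,t]}\right)^T ,\qquad t\in I,$$ which is a Chebyshev function of order $n$ on $I$, and let $$\phi^*(t)=(\phi_1^*(t),\dots,\phi_{n+1}^*(t))^T=\left(L_{\omega_n\omega_{n-1}\cdots\omega_1}^{[a,t]},L_{\omega_n\cdots\omega_2}^{[a,t]},\dots,L_{\omega_n}^{[a,t]},1\right)^T,$$ i.e. $\phi^*_j(t)=L^{[a,t]}_{\omega_n\omega_{n-1}\cdots\omega_j}$ for $1\le j\le n$ and $\phi^*_{n+1}=1$. Then for any pairwise distinct real numbers $u_1,\dots,u_n$ in $I$, the Chebyshev blossom $\varphi=(\varphi_1,\dots,\varphi_n)^T$ of $\phi$ is given by $$\varphi_i(u_1,\dots,u_n)=\frac{D(\phi_1^*,\dots,\phi_i^*,\phi_{i+2}^*,\dots,\phi_{n+1}^*;u_1,\dots,u_n)}{D(\phi_2^*,\phi_3^*,\dots,\phi_{n+1}^*;u_1,\dots,u_n)},\qquad i=1,\dots,n.$$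
   Context: Chen iterated integrals: $L_{\omega_1}^{[a,b]}=\int_a^b\omega_1(t)\,dt$ and $L_{\omega_1\omega_2\cdots\omega_p}^{[a,b]}=\int_a^b\omega_1(t)\,L_{\omega_2\cdots\omega_p}^{[a,t]}\,dt$ for $p\ge2$ (the same definition applies to any list of functions, e.g. $\omega_n,\omega_{n-1},\dots,\omega_j$). Notation: $D(f_1,\dots,f_n;x_1,\dots,x_n)=\det(f_j(x_k))_{1\le j,k\le n}$. Chebyshev function: a $C^\infty$ map $\phi=(\phi_1,\dots,\phi_n)^T:I\to\mathbb{R}^n$ is a Chebyshev function of order $n$ on $I$ if $\mathrm{span}(\phi_1',\dots,\phi_n')$ is an $n$-dimensional extended Chebyshev space on $I$, i.e. each non-zero element has at most $n-1$ zeros on $I$ counting multiplicities. The osculating flat of order $i$ at $t$ is $\mathrm{Osc}_i\phi(t)=\{\phi(t)+\alpha_1\phi'(t)+\dots+\alpha_i\phi^{(i)}(t):\alpha_1,\dots,\alpha_i\in\mathbb{R}\}$. For pairwise distinct $u_1,\dots,u_n\in I$, the Chebyshev blossom value $\varphi(u_1,\dots,u_n)\in\mathbb{R}^n$ is the unique point of $\bigcap_{k=1}^n \mathrm{Osc}_{n-1}\phi(u_k)$. *)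

(* Defs.v *)
From HB Require Import structures.
From mathcomp Require Import all_boot all_order all_algebra.
From mathcomp Require Import all_classical all_reals all_analysis.

Set Implicit Arguments.
Unset Strict Implicit.
Unset Printing Implicit Defensive.

Import Order.TTheory GRing.Theory Num.Theory.
Import numFieldNormedType.Exports.

Local Open Scope classical_set_scope.
Local Open Scope ring_scope.

Section Defs.
Variable R : realType.
Implicit Types (A : set R) (f g : R -> R).

Definition has_two_points A := exists x y, [/\ A x, A y & x < y].

(* Derivatives are taken relative to the interval A, hence are one-sided at an
   endpoint that belongs to A. When A is a singleton the filter below is
   improper: derivable_on holds trivially and derive_on is meaningless. *)
Definition diff_quot f (x y : R) : R := (f y - f x) / (y - x).

Definition derivable_on A f (x : R) : Prop :=
  cvg (diff_quot f x y @[y --> within A x^']).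

Definition derive_on A f (x : R) : R :=
  lim (diff_quot f x y @[y --> within A x^']).

Definition derive_onn A (k : nat) f : R -> R := iter k (derive_on A) f.

Definition smooth_on A f : Prop :=
  forall (k : nat) (x : R), A x -> derivable_on A (derive_onn A k f) x.

Definition oriented_integral (a b : R) f : R :=
  if a <= b then \int[lebesgue_measure]_(t in `[a, b]) f t
  else - \int[lebesgue_measure]_(t in `[b, a]) f t.

(* chen [:: w1; ...; wp] a b is L_{w1 ... wp}^{[a, b]}; the value 1 on the
   empty list makes chen [:: w1] a b the integral of w1. *)
Fixpoint chen (ws : seq (R -> R)) (a b : R) : R :=
  if ws is w :: ws' then oriented_integral a b (fun t => w t * chen ws' a t)
  else 1.

Lemma chen1 (w : R -> R) (a b : R) :
  chen [:: w] a b = oriented_integral a b w.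
Proof. by rewrite /=; congr oriented_integral; apply/funext => t; rewrite mulr1. Qed.

(* D(f_1, ..., f_n; x_1, ..., x_n) *)
Definition colloc_det (n : nat) (f : 'I_n -> R -> R) (x : 'I_n -> R) : R :=
  \det (\matrix_(j < n, k < n) f j (x k)).

(* At most N zeros on A counting multiplicities: m x ranges over all lower
   bounds of the multiplicity of x, so a zero of infinite order is excluded. *)
Definition at_most_zeros A (N : nat) f : Prop :=
  forall (s : seq R) (m : R -> nat),
    uniq s -> (forall x, x \in s -> A x) ->
    (forall x k, x \in s -> (k < m x)%N -> derive_onn A k f x = 0) ->
    (\sum_(x <- s) m x <= N)%N.

(* The span of f_1, ..., f_n, as functions on A, is an n-dimensional extended
   Chebyshev space on A. *)
Definition extended_chebyshev A (n : nat) (f : 'I_n -> R -> R) : Prop :=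
  (forall c : 'I_n -> R,
     (forall t, A t -> \sum_(i < n) c i * f i t = 0) -> forall i, c i = 0) /\
  (forall c : 'I_n -> R,
     (exists t, A t /\ \sum_(i < n) c i * f i t != 0) ->
     at_most_zeros A n.-1 (fun t => \sum_(i < n) c i * f i t)).

Section Curves.
Variables (n : nat) (A : set R) (phi : R -> 'cV[R]_n).

Definition chebyshev_function : Prop :=
  (forall i : 'I_n, smooth_on A (fun t => phi t i ord0)) /\
  extended_chebyshev A (fun i : 'I_n => derive_on A (fun t => phi t i ord0)).

Definition curve_deriv (k : nat) (t : R) : 'cV[R]_n :=
  \col_(i < n) derive_onn A k (fun s => phi s i ord0) t.

Definition osc (i : nat) (t : R) : set 'cV[R]_n :=
  [set p | exists alpha : 'I_i -> R,
     p = phi t + \sum_(k < i) alpha k *: curve_deriv k.+1 t].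

Definition is_blossom_value (u : 'I_n -> R) (p : 'cV[R]_n) : Prop :=
  \bigcap_(k in [set: 'I_n]) osc n.-1 (u k) = [set p].

End Curves.

Definition chen_curve (n : nat) (w : n.-tuple (R -> R)) (a t : R) : 'cV[R]_n :=
  \col_(i < n) chen (take i.+1 w) a t.

(* Indices are shifted by one: dual_chen w a j is phi^*_{j+1}, with weights
   w_n, ..., w_{j+1}; for j = n the list is empty and the function is 1. *)
Definition dual_chen (n : nat) (w : n.-tuple (R -> R)) (a : R)
    (j : 'I_n.+1) (t : R) : R :=
  chen (rev (drop j w)) a t.

(* D(phi^*_1, ..., phi^*_{n+1}; u) with the entry of (shifted) index h left
   out, the others being kept in increasing order. *)
Definition dual_det (n : nat) (w : n.-tuple (R -> R)) (a : R)
    (h : 'I_n.+1) (u : 'I_n -> R) : R :=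
  colloc_det (fun j : 'I_n => dual_chen w a (lift h j)) u.

End Defs.

(* Main.v *)
Require Import Defs.
From HB Require Import structures.
From mathcomp Require Import all_boot all_order all_algebra.
From mathcomp Require Import all_classical all_reals all_analysis.
From mathcomp Require Import ring.

Set Implicit Arguments.
Unset Strict Implicit.
Unset Printing Implicit Defensive.

Import Order.TTheory GRing.Theory Num.Theory.
Import numFieldNormedType.Exports.

Local Open Scope classical_set_scope.
Local Open Scope ring_scope.

(** The curve and its dual are tied by one identity, the convolution of a
word of weights with its reversal: for p >= 1,
  sum_(0 <= j <= p) (-1)^j L_(w_1 .. w_j) L_(w_p .. w_(j+1)) = 0
(lemma [chen_convolution0]). By the Leibniz rule the derivative of this
sum is a combination of the same sums for the two words of length p - 1
obtained by dropping the first or the last letter, and the sum vanishes at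
the base point; so it is zero by induction on p.

Let e_l(t), 0 <= l <= n, be the vector of R^(n+1) whose entry i is
L_(w_(l+1) .. w_i)(t) for i >= l and 0 for i < l. This moving frame is
unitriangular, e_0 is the curve (1, phi), and e_l' = w_(l+1) e_(l+1). Hence
phi', .., phi^(n-1) at t are a triangular combination of e_1, .., e_(n-1)
with the nonzero products w_1 .. w_k on the diagonal, and the osculating
flat of order n - 1 at t is phi(t) + span(e_1, .., e_(n-1)). Applied to the
tails of the word w, the identity says that the linear form
  q |-> sum_(0 <= j <= n) (-1)^j q_j phi^*_(j+1)(t)
kills e_0, .., e_(n-1) but not e_n. So p lies on the flat at t exactly when
this form vanishes at (1, p) ([osc_hyperplane]).

For a point p common to the n flats the numbers (-1)^j q_j, where q = (1, p),
thus form a vector in the kernel of the matrix phi^*_(j+1)(u_k). This kernel is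
spanned by the maximal minors with alternating signs, so q is proportional to
the minors themselves, and q_0 = 1 gives the quotient of determinants
([minors_relation], [minors_unique]), provided that the minor in the
denominator is not zero.

That minor, and the claim that phi is a Chebyshev function, both come from
counting zeros ([chen_comb_zeros]): a nontrivial combination of 1, L_(v_1),
.., L_(v_1 .. v_p) has at most p zeros with multiplicities, since its
derivative is v_1 times a combination of the same kind for the word
v_2 .. v_p, multiplication by the nonvanishing v_1 does not change
multiplicities, and Rolle's theorem loses at most one zero. For the
denominator the word is w_n .. w_2, for the derivative of phi it is
w_2 .. w_n. *)

(** * Derivatives relative to a set *)

Section RelativeDerivative.
Variable R : realType.
Implicit Types (A B : set R) (f g : R -> R).

(** The relational form of [derive_on]: the algebraic rules hold for it on any
set, even when the limit is not unique because the filter is improper. *)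
Definition has_deriv A f (x l : R) : Prop :=
  diff_quot f x y @[y --> within A x^'] --> l.

Definition continuous_rel A f : Prop :=
  forall z, A z -> f u @[u --> within A (nbhs z)] --> f z.

Lemma dnbhs_within A x : within A x^' `=>` within A (nbhs x).
Proof.
by move=> P; rewrite /dnbhs /within /=; apply: filterS => y Py _; exact: Py.
Qed.

Lemma near_within_dnbhs A x (P : R -> Prop) :
  (forall y, A y -> y != x -> P y) -> \forall y \near within A x^', P y.
Proof.
move=> AP; suff: nbhs x (fun y => y != x -> A y -> P y) by [].
apply: (@filterS _ (nbhs x) _ setT); last exact: filterT.
by move=> y _ yx Ay; apply: AP.
Qed.

Lemma has_deriv_ext A f g x l : A x -> (forall y, A y -> f y = g y) ->
  has_deriv A f x l -> has_deriv A g x l.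
Proof.
move=> Ax fg; apply: cvg_trans; apply: near_eq_cvg.
by apply: near_within_dnbhs => y Ay _; rewrite /diff_quot !fg.
Qed.

Lemma has_deriv_sub A B f x l : A `<=` B -> has_deriv B f x l -> has_deriv A f x l.
Proof.
move=> AB; apply: cvg_trans; apply: cvg_app; exact: within_subset.
Qed.

Lemma has_deriv_derivable A f x l : has_deriv A f x l -> derivable_on A f x.
Proof. by move=> /cvgP. Qed.

Lemma has_deriv_cst A (c x : R) : has_deriv A (fun=> c) x 0.
Proof.
rewrite /has_deriv /diff_quot; under eq_cvg do rewrite subrr mul0r.
exact: cvg_cst.
Qed.

Lemma has_deriv_cvg_dnbhs A f x l : has_deriv A f x l ->
  f y @[y --> within A x^'] --> f x.
Proof.
move=> fl.
have yx : (y : R) @[y --> within A x^'] --> x.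
  move=> P /= Px; apply: dnbhs_within; exact: cvg_within Px.
have : f x + diff_quot f x y * (y - x) @[y --> within A x^'] --> f x + l * (x - x).
  by apply: cvgD; [exact: cvg_cst|apply: cvgM => //; apply: cvgB => //; exact: cvg_cst].
rewrite subrr mulr0 addr0; apply: cvg_trans; apply: near_eq_cvg.
apply: near_within_dnbhs => y _ yx'; rewrite /diff_quot divfK ?subr_eq0 //; ring.
Qed.

(** The relative derivative ignores the value at x; adding the point x back to
the punctured filter is harmless because the limit is the value itself. *)
Lemma has_deriv_cvg A f x l : has_deriv A f x l ->
  f y @[y --> within A (nbhs x)] --> f x.
Proof.
move=> /has_deriv_cvg_dnbhs fx P Px.
suff: nbhs x (fun y => A y -> P (f y)) by [].
have : nbhs x (fun y => y != x -> A y -> P (f y)) by exact: fx _ Px.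
apply: filterS => y; have [->|yx] := eqVneq y x; last by move=> /(_ isT).
by move=> _ _; exact: nbhs_singleton.
Qed.

Lemma has_derivD A f g x k l : has_deriv A f x k -> has_deriv A g x l ->
  has_deriv A (fun y => f y + g y) x (k + l).
Proof.
move=> fk gl; apply: cvg_trans (cvgD fk gl); apply: near_eq_cvg.
by apply: near_within_dnbhs => y _ _ /=; rewrite /diff_quot !fctE; move: (y - x)^-1 => d; ring.
Qed.

Lemma has_derivM A f g x k l : has_deriv A f x k -> has_deriv A g x l ->
  has_deriv A (fun y => f y * g y) x (k * g x + f x * l).
Proof.
move=> fk gl.
apply: cvg_trans (cvgD (cvgM fk (has_deriv_cvg_dnbhs gl)) (cvgM (cvg_cst (f x)) gl)).
apply: near_eq_cvg.
by apply: near_within_dnbhs => y _ _ /=; rewrite /diff_quot !fctE /cst/=;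
  move: (y - x)^-1 => d; ring.
Qed.

Lemma has_derivZ A f (c x l : R) : has_deriv A f x l ->
  has_deriv A (fun y => c * f y) x (c * l).
Proof.
by move=> fl; have := has_derivM (has_deriv_cst A c x) fl; rewrite mul0r add0r.
Qed.

Lemma has_deriv_sum A (I : Type) (r : seq I) (F : I -> R -> R) (l : I -> R) x :
  (forall i, has_deriv A (F i) x (l i)) ->
  has_deriv A (fun y => \sum_(i <- r) F i y) x (\sum_(i <- r) l i).
Proof.
move=> Fl; elim: r => [|i r IH].
  rewrite big_nil (_ : (fun y => _) = fun=> 0); first exact: has_deriv_cst.
  by apply/funext => y; rewrite big_nil.
rewrite big_cons (_ : (fun y => _) = fun y => F i y + \sum_(j <- r) F j y).
  exact: has_derivD.
by apply/funext => y; rewrite big_cons.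
Qed.

Lemma near_dnbhs_shift (x : R) (P : R -> Prop) :
  (\forall y \near x^', P y) <-> (\forall h \near 0^', P (h + x)).
Proof.
have -> : (\forall y \near x^', P y) = \forall y \near x, y != x -> P y by [].
rewrite (near_shift 0 x) subr0.
suff -> : (fun y => y != x -> P y) \o shift x = (fun h => h != 0 -> P (h + x)) by [].
by apply/funext => z /=; rewrite -[z + x == x]subr_eq0 addrK.
Qed.

Lemma is_derive_has_deriv A f (x l : R) : is_derive x 1 f l -> has_deriv A f x l.
Proof.
move=> [df fl].
have : h^-1 *: ((f \o shift x) (h *: 1) - f x) @[h --> 0^'] --> l by rewrite -fl.
move=> H; apply: (@has_deriv_sub _ setT) => // P Pl.
have H1 : \forall h \near 0^', P (h^-1 *: ((f \o shift x) (h *: 1) - f x)).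
  exact: H P Pl.
have : \forall y \near x^', P (diff_quot f x y).
  apply/near_dnbhs_shift; apply: filterS H1 => h /=.
  by rewrite /diff_quot addrK [_ *: 1]mulr1 [_ *: _]mulrC.
by apply: filterS => y.
Qed.

Lemma has_deriv_is_derive A f (x l : R) : nbhs x A -> has_deriv A f x l ->
  is_derive x 1 f l.
Proof.
move=> Ax H.
have H' : h^-1 *: ((f \o shift x) (h *: 1) - f x) @[h --> 0^'] --> l.
  move=> P Pl; have H1 : \forall y \near x^', A y -> P (diff_quot f x y) by exact: H P Pl.
  have : \forall y \near x^', P (diff_quot f x y).
    by apply: filterS2 H1 (nbhs_dnbhs Ax) => y; apply.
  move=> /near_dnbhs_shift; apply: filterS => h /=.
  by rewrite /diff_quot addrK [_ *: 1]mulr1 [_ *: _]mulrC.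
by apply: DeriveDef; [apply: cvgP H'|apply: cvg_lim H'].
Qed.

End RelativeDerivative.

(** * Mean value theorem and primitives on an interval *)

Section Interval.
Variable R : realType.
Implicit Types (A B : set R) (f g : R -> R).

(** In an interval with two points every point is a limit of others, on the left
or on the right; this makes relative derivatives unique. *)
Lemma within_dnbhs_proper A x : is_interval A -> has_two_points A -> A x ->
  ProperFilter (within A x^').
Proof.
move=> iA [p [q [Ap Aq pq]]] Ax; apply: Build_ProperFilter => H.
have {}H : \forall y \near x, y != x -> A y -> False by exact: H.
have [xq|qx] := ltP x q.
  have : \forall y \near x^'+, False.
    near=> y; have yq : y < q by near: y; exact: nbhs_right_lt.
    have xy : x < y by near: y; exact: nbhs_right_gt.
    have : y != x -> A y -> False by near: y; exact: cvg_within H.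
    apply; first by rewrite gt_eqF.
    by apply: (iA x q) => //; rewrite (ltW xy) (ltW yq).
  by move/filter_ex => [].
have px := lt_le_trans pq qx.
have : \forall y \near x^'-, False.
  near=> y; have yq : p < y by near: y; exact: nbhs_left_gt.
  have xy : y < x by near: y; exact: nbhs_left_lt.
  have : y != x -> A y -> False by near: y; exact: cvg_within H.
  apply; first by rewrite lt_eqF.
  by apply: (iA p x) => //; rewrite (ltW xy) (ltW yq).
by move/filter_ex => [].
Unshelve. all: by end_near. Qed.

Lemma has_deriv_unique A f x l : is_interval A -> has_two_points A -> A x ->
  has_deriv A f x l -> derive_on A f x = l.
Proof.
move=> iA A2 Ax fl; have pA := within_dnbhs_proper iA A2 Ax.
exact: cvg_lim fl.
Qed.

Lemma interval_nbhs A x y z : is_interval A -> A x -> A z -> x < y < z -> nbhs y A.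
Proof.
move=> iA Ax Az /andP[xy yz].
have : \forall u \near y, u \in `]x, z[ by apply: near_in_itvoo; rewrite in_itv /= xy.
apply: filterS => u; rewrite in_itv /= => /andP[xu uz].
by apply: (iA x z) => //; rewrite !ltW.
Qed.

Lemma cvg_within_itv_continuous A f x y : is_interval A -> A x -> A y ->
  continuous_rel A f ->
  {within `[x, y], continuous f}.
Proof.
move=> iA Ax Ay fc; apply/subspace_continuousP => z /= xyz.
have sA : [set` `[x, y]] `<=` A.
  by move=> u /=; rewrite in_itv /= => /(iA x y); exact.
apply: cvg_trans (fc z (sA _ xyz)); apply: cvg_app; exact: within_subset.
Qed.

Lemma Rolle_on A f f' x y : is_interval A -> A x -> A y -> x < y ->
  (forall z, A z -> has_deriv A f z (f' z)) -> f x = f y ->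
  exists2 z, x < z < y & f' z = 0.
Proof.
move=> iA Ax Ay xy ff' fxy.
have df z : z \in `]x, y[ -> is_derive z 1 f (f' z).
  rewrite in_itv /= => xzy.
  have zA : nbhs z A := interval_nbhs iA Ax Ay xzy.
  exact: has_deriv_is_derive zA (ff' _ (nbhs_singleton zA)).
have cf : {within `[x, y], continuous f}.
  by apply: cvg_within_itv_continuous iA Ax Ay _ => z /ff' /has_deriv_cvg.
have [z xyz fz] : exists2 c, c \in `]x, y[%R & is_derive c 1 f 0.
  by apply: Rolle => // z zxy; have [] := df z zxy.
exists z; first by rewrite in_itv in xyz.
by have [_ <-] := df z xyz; have [_ ->] := fz.
Qed.

Lemma has_deriv0_cst A f x y : is_interval A -> A x -> A y ->
  (forall z, A z -> has_deriv A f z 0) -> f x = f y.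
Proof.
move=> iA Ax Ay f0; wlog xy : x y Ax Ay / x < y => [hw|].
  by have [/hw->|/hw->|->] := ltgtP x y.
have df z : z \in `]x, y[ -> is_derive z 1 f 0.
  rewrite in_itv /= => xzy.
  have zA : nbhs z A := interval_nbhs iA Ax Ay xzy.
  exact: has_deriv_is_derive zA (f0 _ (nbhs_singleton zA)).
have cf : {within `[x, y], continuous f}.
  by apply: cvg_within_itv_continuous iA Ax Ay _ => z /f0 /has_deriv_cvg.
have [z _] := @MVT R f (fun=> 0) x y xy df cf.
by rewrite mul0r => /eqP; rewrite subr_eq0 => /eqP.
Qed.

Lemma oriented_integralxx f x : oriented_integral x x f = 0.
Proof. by rewrite /oriented_integral lexx set_itv1 Rintegral_set1. Qed.

(** Composing with the projection onto [c, d] turns a function that is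
continuous relative to an interval, at whose endpoints nothing is known from
outside, into one that is continuous on the whole line. *)
Definition clamp (c d x : R) : R := Num.max c (Num.min d x).

Lemma clamp_bounds c d x : c <= d -> c <= clamp c d x <= d.
Proof. by move=> cd; rewrite /clamp le_max lexx ge_max cd ge_min lexx. Qed.

Lemma clamp_id c d x : c <= x <= d -> clamp c d x = x.
Proof. by move=> /andP[cx xd]; rewrite /clamp (min_idPr xd) (max_idPr cx). Qed.

Lemma continuous_clamp c d : continuous (clamp c d).
Proof.
move=> x; apply: (@continuous_max _ _ (fun=> c) (fun y => Num.min d y)).
  exact: cvg_cst.
by apply: (@continuous_min _ _ (fun=> d) id); [exact: cvg_cst|exact: cvg_id].
Qed.

Lemma continuous_comp_clamp A f c d : is_interval A -> A c -> A d -> c <= d ->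
  continuous_rel A f ->
  continuous (f \o clamp c d).
Proof.
move=> iA Ac Ad cd fc x.
have Acl y : A (clamp c d y) by apply: (iA c d) => //; exact: clamp_bounds.
apply: (cvg_comp (clamp c d) f) (fc _ (Acl x)) => P Px.
have : \forall y \near x, A (clamp c d y) -> P (clamp c d y).
  exact: continuous_clamp Px.
suff sub : [set y | A (clamp c d y) -> P (clamp c d y)] `<=` [set y | P (clamp c d y)].
  exact: filterS sub.
by move=> y /(_ (Acl y)).
Qed.


Lemma continuous_itv_integrable (h : R -> R) (c d : R) : continuous h ->
  lebesgue_measure.-integrable `[c, d] (EFin \o h).
Proof.
move=> ch; apply: continuous_compact_integrable; first exact: segment_compact.
by apply: continuous_subspaceT.
Qed.

Lemma oriented_integral_primitive (h : R -> R) (c x y : R) : continuous h ->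
  c <= x -> c <= y ->
  oriented_integral x y h =
  \int[lebesgue_measure]_(t in `[c, y]) h t - \int[lebesgue_measure]_(t in `[c, x]) h t.
Proof.
move=> ch; have key u v : c <= u -> u <= v ->
    \int[lebesgue_measure]_(t in `[u, v]) h t =
    \int[lebesgue_measure]_(t in `[c, v]) h t - \int[lebesgue_measure]_(t in `[c, u]) h t.
  move=> cu uv; rewrite Rintegral_itvB ?bnd_simp //; last exact: continuous_itv_integrable.
  rewrite Rintegral_itv_obnd_cbnd //.
  apply: integrableS (continuous_itv_integrable u v ch) => //.
  exact: subset_itv_oc_cc.
move=> cx cy; rewrite /oriented_integral; case: leP => xy; first exact: key.
by rewrite key // ?ltW // opprB.
Qed.

Lemma eq_oriented_integral A f g x y : is_interval A -> A x -> A y ->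
  (forall t, A t -> f t = g t) -> oriented_integral x y f = oriented_integral x y g.
Proof.
move=> iA Ax Ay fg; rewrite /oriented_integral.
by case: ifP => _; last congr (- _); apply: eq_Rintegral => t;
  rewrite inE /= in_itv /= => txy; apply: fg; exact: iA txy.
Qed.

(** Fundamental theorem of calculus relative to an interval. Near x the interval
A is contained in a segment [c, d] of A that also contains x0; there the
integrand agrees with its clamped extension h, whose integral from c - 1 has
a two-sided derivative at every point of the segment. Starting one unit before
c makes x interior even when x = c, and replaces the sign cases of the oriented
integral by a difference of two primitives. *)
Lemma has_deriv_oriented_integral A g x0 x : is_interval A -> A x0 -> A x ->
  continuous_rel A g ->
  has_deriv A (oriented_integral x0 ^~ g) x (g x).
Proof.
move=> iA Ax0 Ax gc.
(* if no point of A lies before x, then x itself bounds A from below *)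
have [c [Ac cx0 cx nc]] : exists c, [/\ A c, c <= x0, c <= x &
    \forall y \near x, A y -> c <= y].
  have [[p [Ap px]]|np] := pselect (exists p, A p /\ p < x).
    exists (Num.min p x0); split; rewrite ?ge_min ?lexx ?(ltW px) ?orbT //.
      by rewrite /Num.min; case: ifP.
    by have := lt_nbhsr px; apply: filterS => y py _; rewrite ge_min (ltW py).
  have xA y : A y -> x <= y.
    by move=> Ay; rewrite leNgt; apply/negP => yx; apply: np; exists y.
  exists x; split => //; first exact: xA.
  by apply: (@filterS _ (nbhs x) _ setT); [move=> y _; exact: xA|exact: filterT].
have [d [Ad dx0 dx nd]] : exists d, [/\ A d, x0 <= d, x <= d &
    \forall y \near x, A y -> y <= d].
  have [[p [Ap px]]|np] := pselect (exists p, A p /\ x < p).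
    exists (Num.max p x0); split; rewrite ?le_max ?lexx ?(ltW px) ?orbT //.
      by rewrite /Num.max; case: ifP.
    by have := lt_nbhsl px; apply: filterS => y py _; rewrite le_max (ltW py).
  have xA y : A y -> y <= x.
    by move=> Ay; rewrite leNgt; apply/negP => yx; apply: np; exists y.
  exists x; split => //; first exact: xA.
  by apply: (@filterS _ (nbhs x) _ setT); [move=> y _; exact: xA|exact: filterT].
pose h := g \o clamp c d.
have ch : continuous h.
  by apply: continuous_comp_clamp iA Ac Ad _ gc; exact: le_trans dx.
have hg t : c <= t <= d -> h t = g t by move=> ctd; rewrite /h /= clamp_id.
pose P t := \int[lebesgue_measure]_(s in `[c - 1, t]) h s.
have dP : has_deriv A (fun t => P t - P x0) x (g x).
  rewrite -(hg x) ?cx // -[h x]addr0; apply: has_derivD; last exact: has_deriv_cst.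
  apply: is_derive_has_deriv.
  have [||||dP Px] := @continuous_FTC1_closed R h (c - 1) x (x + 1).
  - by rewrite ltrDl.
  - exact: continuous_itv_integrable.
  - by rewrite ltrBlDr (le_lt_trans cx) // ltrDl.
  - exact: ch.
  by apply: DeriveDef; [exact: dP|rewrite -derive1E].
have eqP y : A y -> c <= y <= d -> P y - P x0 = oriented_integral x0 y g.
  move=> Ay /andP[cy yd]; rewrite /P -oriented_integral_primitive //; last 2 first.
  - by apply: le_trans cx0; rewrite lerBlDr lerDl.
  - by apply: le_trans cy; rewrite lerBlDr lerDl.
  apply: (@eq_oriented_integral `[c, d]%classic); rewrite /= ?in_itv /= ?cx0 ?cy //.
  exact: interval_is_interval.
apply: cvg_trans dP; apply: near_eq_cvg.
have : \forall y \near x, A y -> diff_quot (fun t => P t - P x0) x y =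
    diff_quot (oriented_integral x0 ^~ g) x y.
  apply: filterS2 nc nd => y cy yd Ay.
  by rewrite /diff_quot !eqP ?cx ?cy ?yd.
by move=> H; suff: \forall y \near x^', A y ->
    diff_quot (fun t => P t - P x0) x y = diff_quot (oriented_integral x0 ^~ g) x y;
  [by []|exact: nbhs_dnbhs].
Qed.

End Interval.

(** * Smooth functions and multiplicities of zeros *)

Section Smooth.
Variables (R : realType) (A : set R).
Hypotheses (iA : is_interval A) (A2 : has_two_points A).
Implicit Types (f g w : R -> R).

Lemma derive_on_ext f g x : A x -> (forall y, A y -> f y = g y) ->
  derive_on A f x = derive_on A g x.
Proof.
move=> Ax fg; rewrite /derive_on /lim /lim_in; congr get; apply/funext => l.
have gf y : A y -> g y = f y by move=> /fg.
by apply/propext; split; [exact: (has_deriv_ext Ax fg)|exact: (has_deriv_ext Ax gf)].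
Qed.

Lemma derive_onn_ext k f g x : A x -> (forall y, A y -> f y = g y) ->
  derive_onn A k f x = derive_onn A k g x.
Proof.
move=> Ax fg; elim: k x Ax => [|k IH] x Ax; first exact: fg.
by rewrite /derive_onn !iterS; exact: derive_on_ext.
Qed.

Lemma derive_onnSr k f : derive_onn A k.+1 f = derive_onn A k (derive_on A f).
Proof. by rewrite /derive_onn iterSr. Qed.

(** Smoothness unfolded from the first derivative inwards, so that the product
rule can be iterated by induction with both factors generalized. *)
Fixpoint times_derivable (k : nat) f : Prop :=
  if k is k'.+1 then
    (forall x, A x -> derivable_on A f x) /\ times_derivable k' (derive_on A f)
  else True.

Lemma smooth_times_derivable f :
  smooth_on A f <-> forall k, times_derivable k f.
Proof.
split=> [sf k|df k].
  have : forall j x, A x -> derivable_on A (derive_onn A j f) x by exact: sf.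
  elim: k f {sf} => //= k IH f df; split; first exact: (df 0%N).
  by apply: IH => j x Ax; rewrite -derive_onnSr; exact: df.
have := df k.+1; elim: k f {df} => [|k IH] f [df ddf] x Ax; first exact: df.
by rewrite derive_onnSr; exact: IH.
Qed.

Lemma times_derivable_ext k f g : (forall y, A y -> f y = g y) ->
  times_derivable k f -> times_derivable k g.
Proof.
elim: k f g => //= k IH f g fg [df ddf]; split.
  by move=> x Ax; apply: has_deriv_derivable (has_deriv_ext Ax fg (df x Ax)).
by apply: IH ddf => y Ay; apply: derive_on_ext.
Qed.

Lemma times_derivableW k f : times_derivable k.+1 f -> times_derivable k f.
Proof. by elim: k f => // k IH f [df ddf]; split => //; exact: IH. Qed.

Lemma times_derivableS k f f' : (forall x, A x -> has_deriv A f x (f' x)) ->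
  times_derivable k f' -> times_derivable k.+1 f.
Proof.
move=> ff' df'; split; first by move=> x /ff'; exact: has_deriv_derivable.
by apply: times_derivable_ext df' => x Ax; rewrite (has_deriv_unique _ _ _ (ff' x Ax)).
Qed.

Lemma times_derivable_cst k c : times_derivable k (fun=> c).
Proof.
elim: k c => // k IH c; apply: times_derivableS (IH 0) => x _; exact: has_deriv_cst.
Qed.

Lemma times_derivableD k f g : times_derivable k f -> times_derivable k g ->
  times_derivable k (fun x => f x + g x).
Proof.
elim: k f g => // k IH f g [df ddf] [dg ddg].
apply: times_derivableS (IH _ _ ddf ddg) => x Ax.
by apply: has_derivD; [exact: df|exact: dg].
Qed.

Lemma times_derivableM k f g : times_derivable k f -> times_derivable k g ->
  times_derivable k (fun x => f x * g x).
Proof.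
elim: k f g => // k IH f g kf kg; have [df ddf] := kf; have [dg ddg] := kg.
apply: (@times_derivableS _ _ (fun x => derive_on A f x * g x + f x * derive_on A g x)).
  by move=> x Ax; apply: has_derivM; [exact: df|exact: dg].
by apply: times_derivableD; apply: IH => //; exact: times_derivableW.
Qed.

Lemma smooth_ext f g : (forall y, A y -> f y = g y) -> smooth_on A f -> smooth_on A g.
Proof.
move=> fg /smooth_times_derivable sf; apply/smooth_times_derivable => k.
exact: times_derivable_ext fg (sf k).
Qed.

Lemma smooth_cst c : smooth_on A (fun=> c).
Proof. by apply/smooth_times_derivable => k; exact: times_derivable_cst. Qed.

Lemma smoothD f g : smooth_on A f -> smooth_on A g -> smooth_on A (fun x => f x + g x).
Proof.
move=> /smooth_times_derivable sf /smooth_times_derivable sg.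
by apply/smooth_times_derivable => k; exact: times_derivableD.
Qed.

Lemma smoothM f g : smooth_on A f -> smooth_on A g -> smooth_on A (fun x => f x * g x).
Proof.
move=> /smooth_times_derivable sf /smooth_times_derivable sg.
by apply/smooth_times_derivable => k; exact: times_derivableM.
Qed.

Lemma smooth_sum n (F : 'I_n -> R -> R) : (forall i, smooth_on A (F i)) ->
  smooth_on A (fun x => \sum_(i < n) F i x).
Proof.
move=> sF; elim: (index_enum _) => [|i r IH].
  by apply: (smooth_ext _ (@smooth_cst 0)) => y _; rewrite big_nil.
by apply: (smooth_ext _ (smoothD (sF i) IH)) => y _; rewrite big_cons.
Qed.

Lemma smooth_has_deriv f x : smooth_on A f -> A x -> has_deriv A f x (derive_on A f x).
Proof. by move=> sf Ax; exact: (sf 0%N). Qed.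

Lemma smooth_derive f : smooth_on A f -> smooth_on A (derive_on A f).
Proof.
by move=> sf k x Ax; rewrite -derive_onnSr; exact: sf.
Qed.

Lemma has_deriv_smooth f f' : (forall x, A x -> has_deriv A f x (f' x)) ->
  smooth_on A f' -> smooth_on A f.
Proof.
move=> ff' /smooth_times_derivable sf'; apply/smooth_times_derivable => k.
by apply: times_derivableW; exact: times_derivableS ff' (sf' k).
Qed.

Lemma derive_onnD k f g x : smooth_on A f -> smooth_on A g -> A x ->
  derive_onn A k (fun y => f y + g y) x = derive_onn A k f x + derive_onn A k g x.
Proof.
elim: k f g => // k IH f g sf sg Ax.
rewrite !derive_onnSr -IH //; [|exact: smooth_derive..].
apply: derive_onn_ext => // y Ay; apply: has_deriv_unique => //.
by apply: has_derivD; exact: smooth_has_deriv.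
Qed.

Lemma derive_onn0 k x : A x -> derive_onn A k (fun=> 0) x = 0.
Proof.
elim: k => // k IH Ax; rewrite derive_onnSr -[RHS]IH //.
apply: derive_onn_ext => // y Ay; apply: has_deriv_unique => //.
exact: has_deriv_cst.
Qed.

(** In Leibniz' formula at a zero of order m of g only the term w g^(m)
survives. *)
Lemma derive_onnM_vanishing m w g x : smooth_on A w -> smooth_on A g -> A x ->
  (forall k, (k < m)%N -> derive_onn A k g x = 0) ->
  derive_onn A m (fun y => w y * g y) x = w x * derive_onn A m g x.
Proof.
elim: m w g => // m IH w g sw sg Ax g0.
have [sw' sg'] := (smooth_derive sw, smooth_derive sg).
have -> : derive_onn A m.+1 (fun y => w y * g y) x =
    derive_onn A m (fun y => derive_on A w y * g y + w y * derive_on A g y) x.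
  rewrite derive_onnSr; apply: derive_onn_ext => // y Ay.
  by apply: has_deriv_unique => //; apply: has_derivM; exact: smooth_has_deriv.
rewrite derive_onnD //; [|exact: smoothM..].
rewrite IH //; last by move=> k km; apply: g0; exact: ltnW.
rewrite g0 // mulr0 add0r IH -?derive_onnSr // => k km.
by rewrite -derive_onnSr g0.
Qed.

Lemma at_most_zeros_ext N f g : (forall x, A x -> f x = g x) ->
  at_most_zeros A N f -> at_most_zeros A N g.
Proof.
move=> fg zf s m us sA gs; apply: zf => // x k xs km.
by rewrite (derive_onn_ext k (sA x xs) fg) gs.
Qed.

(** By [derive_onnM_vanishing] and induction on the order of derivation, a zero of
w g is a zero of g of at least the same multiplicity. *)
Lemma at_most_zerosM N w g : smooth_on A w -> smooth_on A g ->
  (forall x, A x -> w x != 0) ->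
  at_most_zeros A N g -> at_most_zeros A N (fun x => w x * g x).
Proof.
move=> sw sg w0 zg s m us sA wgs; apply: zg => // x k xs.
have [k' kk'] := ubnP k; elim: k' k kk' => // k' IH k kk' km.
have := wgs x k xs km; rewrite derive_onnM_vanishing //; last 2 first.
- exact: sA.
- by move=> j jk; apply: IH (ltn_trans jk km); exact: leq_trans jk kk'.
by move/eqP; rewrite mulf_eq0 (negPf (w0 _ (sA _ xs))) => /eqP.
Qed.

(** One zero of f' strictly between any two consecutive zeros of f; avoiding
the tail of the list and lying beyond x keeps it distinct from all
the zeros of f. *)
Lemma Rolle_points f f' x s : (forall z, A z -> has_deriv A f z (f' z)) ->
  path <%R x s -> (forall z, z \in x :: s -> A z /\ f z = 0) ->
  exists ys, [/\ size ys = size s, uniq ys &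
    forall y, y \in ys -> [/\ A y, x < y, y \notin s & f' y = 0]].
Proof.
move=> ff'; elim: s x => [|x2 s IH] x /=; first by exists [::].
move=> /andP[xx2 x2s] fs.
have fs2 z : z \in x2 :: s -> A z /\ f z = 0.
  by move=> zs; apply: fs; rewrite inE zs orbT.
have [ys [sys uys ysP]] := IH x2 x2s fs2.
have [[Ax fx] [Ax2 fx2]] := (fs x (mem_head _ _), fs2 x2 (mem_head _ _)).
have [y /andP[xy yx2] f'y] := Rolle_on iA Ax Ax2 xx2 ff' (etrans fx (esym fx2)).
exists (y :: ys); split; first by rewrite /= sys.
  by rewrite /= uys andbT; apply/negP => /ysP[_ /(lt_trans yx2)]; rewrite ltxx.
move=> z; rewrite inE => /predU1P[->|/ysP[Az x2z zs f'z]]; last first.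
  by split; rewrite // ?(lt_trans xx2) // inE negb_or zs gt_eqF.
split => //.
  by apply: (iA Ax Ax2); rewrite (ltW xy) (ltW yx2).
rewrite inE negb_or lt_eqF //=; apply/negP => ys'.
have /allP/(_ y ys') := order_path_min lt_trans x2s.
by move/(lt_trans yx2); rewrite ltxx.
Qed.

(** Let f have r distinct zeros of multiplicities m_i >= 1. Then f' has
multiplicity at least m_i - 1 at each of them, and r - 1 further zeros in
between: at least (sum of the m_i) - 1 in total. *)
Lemma at_most_zeros_Rolle N f f' : smooth_on A f ->
  (forall x, A x -> has_deriv A f x (f' x)) ->
  at_most_zeros A N f' -> at_most_zeros A N.+1 f.
Proof.
move=> sf ff' zf' s m us sA fs.
(* zeros of claimed multiplicity 0 must be discarded: f need not vanish there *)
pose s1 := sort <=%R [seq x <- s | (0 < m x)%N].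
have s1P x : (x \in s1) = (0 < m x)%N && (x \in s) by rewrite mem_sort mem_filter.
have us1 : uniq s1 by rewrite sort_uniq filter_uniq.
have -> : (\sum_(x <- s) m x = \sum_(x <- s1) m x)%N.
  rewrite (perm_big _ (permEl (perm_sort _ _))) /= big_filter [RHS]big_mkcond.
  by apply: eq_bigr => x _; case: posnP.
have ss1 : sorted <%R s1 by rewrite lt_sorted_uniq_le us1 sort_le_sorted.
have [->|[x [t s1E]]] : s1 = [::] \/ exists x t, s1 = x :: t.
- by case: (s1) => [|x t]; [left|right; exists x, t].
- by rewrite big_nil.
have s1f z : z \in s1 -> A z /\ f z = 0.
  rewrite s1P => /andP[mz zs]; split; [exact: sA|exact: (fs z 0%N)].
have [ys [sys uys ysP]] : exists ys, [/\ size ys = size t, uniq ys &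
    forall y, y \in ys -> [/\ A y, x < y, y \notin t & f' y = 0]].
  by apply: Rolle_points ff' _ _; rewrite -?s1E //; move: ss1; rewrite s1E.
have ysN y : y \in ys -> y \notin s1.
  by move=> /ysP[_ xy yt _]; rewrite s1E inE negb_or yt gt_eqF.
pose m' z := if z \in s1 then (m z).-1 else 1%N.
have := zf' (s1 ++ ys) m'; rewrite big_cat /=.
have -> : (\sum_(z <- ys) m' z = size t)%N.
  rewrite -sys -sum1_size; apply: eq_big_seq => z zys.
  by rewrite /m' (negPf (ysN _ zys)).
have <- : (\sum_(z <- s1) m' z + size s1 = \sum_(z <- s1) m z)%N.
  rewrite -sum1_size -big_split /=; apply: eq_big_seq => z zs1.
  by rewrite /m' zs1 addn1 prednK //; move: zs1; rewrite s1P => /andP[].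
rewrite [in size s1]s1E /= addnS ltnS; apply.
- rewrite cat_uniq us1 uys andbT /=.
  by apply/hasPn => y /ysN.
- by move=> z; rewrite mem_cat => /orP[/s1f[]|/ysP[]].
move=> z k; rewrite mem_cat /m' => zs.
case: ifPn => zs1 km.
  have := zs1; rewrite s1P => /andP[mz zs'].
  rewrite -(@derive_onn_ext k (derive_on A f)); last 2 first.
  - exact: sA.
  - by move=> y Ay; exact: has_deriv_unique (ff' y Ay).
  by rewrite -derive_onnSr fs // -(prednK mz).
move: zs; rewrite (negPf zs1) /= => /ysP[_ _ _ f'z].
by move: km; rewrite ltnS leqn0 => /eqP ->.
Qed.

Lemma at_most_zeros_cst c : c != 0 -> at_most_zeros A 0 (fun=> c).
Proof.
move=> c0 s m us sA cs; rewrite big1_seq // => x /andP[_ xs].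
have [->//|mx] := posnP (m x).
by have /eqP := cs x 0%N xs mx; rewrite /= (negPf c0).
Qed.

End Smooth.

Lemma derive_onn_sub (R : realType) (A B : set R) k (f : R -> R) x :
  is_interval A -> has_two_points A -> A `<=` B -> smooth_on B f -> A x ->
  derive_onn A k f x = derive_onn B k f x.
Proof.
move=> iA A2 AB sf; elim: k f sf x => // k IH f sf x Ax.
rewrite derive_onnSr (@derive_onn_ext _ _ _ _ (derive_on B f)) //.
  by rewrite IH ?derive_onnSr //; exact: smooth_derive.
move=> y Ay; apply: has_deriv_unique => //; apply: (has_deriv_sub AB).
by apply: smooth_has_deriv => //; exact: AB.
Qed.

Lemma smooth_sub (R : realType) (A B : set R) (f : R -> R) :
  is_interval A -> has_two_points A -> A `<=` B -> smooth_on B f -> smooth_on A f.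
Proof.
move=> iA A2 AB sf k x Ax.
apply: (@has_deriv_derivable _ _ _ _ (derive_onn B k.+1 f x)).
apply: (@has_deriv_ext _ _ (derive_onn B k f)) => //.
  by move=> y Ay; rewrite (derive_onn_sub k iA A2 AB sf Ay).
by apply: (has_deriv_sub AB); apply: (sf k); exact: AB.
Qed.

(** * Iterated integrals and their convolution identity *)

Lemma smooth_continuous_rel (R : realType) (A : set R) (f : R -> R) :
  smooth_on A f -> continuous_rel A f.
Proof. by move=> sf z Az; apply: has_deriv_cvg (smooth_has_deriv sf Az). Qed.

Section Chen.
Variables (R : realType) (J : set R) (a : R).
Hypotheses (iJ : is_interval J) (Ja : J a).
Implicit Types (ws : seq (R -> R)).

Lemma chen_continuous ws : (forall w, w \in ws -> continuous_rel J w) ->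
  continuous_rel J (chen ws a).
Proof.
elim: ws => [|w ws IH] cws z Jz; first exact: cvg_cst.
apply: has_deriv_cvg; apply: has_deriv_oriented_integral => // y Jy.
apply: cvgM; first by apply: cws => //; exact: mem_head.
by apply: IH => // v vws; apply: cws; rewrite inE vws orbT.
Qed.

Lemma has_deriv_chen w ws t : (forall v, v \in w :: ws -> continuous_rel J v) ->
  J t -> has_deriv J (chen (w :: ws) a) t (w t * chen ws a t).
Proof.
move=> cws Jt; apply: (has_deriv_oriented_integral (g := fun u => w u * chen ws a u)) => // y Jy.
apply: cvgM; first by apply: cws => //; exact: mem_head.
by apply: chen_continuous => // v vws; apply: cws; rewrite inE vws orbT.
Qed.

Lemma chen_base ws : (0 < size ws)%N -> chen ws a a = 0.
Proof. by case: ws => // w ws _; exact: oriented_integralxx. Qed.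

(** The left-hand side of the antipode relation for the shuffle Hopf algebra,
evaluated on the signature of the path. *)
Definition chen_convolution ws t : R :=
  \sum_(j < (size ws).+1) (-1) ^+ j * (chen (take j ws) a t * chen (rev (drop j ws)) a t).

(** Differentiating, w_1 comes out of every left factor except the empty one, and
w_p out of every right factor except the empty one; what remains are, up to
the factors - w_1 and w_p, the same sums for the words without first and
without last letter. The one-letter word is checked directly. *)
Lemma chen_convolution0 ws t : (forall w, w \in ws -> continuous_rel J w) ->
  J t -> (0 < size ws)%N -> chen_convolution ws t = 0.
Proof.
have [p] := ubnP (size ws); elim: p ws t => // p IH [//|w s] t sp cws Jt _.
case/lastP: s => [|v w'] in sp cws *.
  by rewrite /chen_convolution !big_ord_recl big_ord0 /= !expr0 expr1; ring.
set ws := w :: rcons v w'.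
have mv : {subset w :: v <= ws}.
  by move=> u; rewrite !inE mem_rcons inE => /orP[->//|->]; rewrite !orbT.
have mv' : {subset rcons v w' <= ws} by move=> u; rewrite inE => ->; rewrite orbT.
have sws : size ws = (size (w :: v)).+1 by rewrite /= size_rcons.
have IH1 y : J y -> chen_convolution (rcons v w') y = 0.
  by move=> Jy; apply: IH => //; [move=> u /mv'; exact: cws|rewrite size_rcons].
have IH2 y : J y -> chen_convolution (w :: v) y = 0.
  move=> Jy; apply: IH => //; last by move=> u /mv; exact: cws.
  by move: sp; rewrite /= size_rcons.
have cst0 : chen_convolution ws a = 0.
  rewrite /chen_convolution big1 // => -[[|j] jlt] _ /=.
    by rewrite chen_base ?mulr0 // rev_cons size_rcons.
  by rewrite oriented_integralxx mul0r mulr0.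
rewrite -cst0; apply: has_deriv0_cst iJ Jt Ja _ => z Jz.
(* l j and r j are the derivatives at z of the left and right factors *)
pose l j := if j is j'.+1 then w z * chen (take j' (rcons v w')) a z else 0.
pose r j := if (j <= size (w :: v))%N then w' z * chen (rev (drop j (w :: v))) a z else 0.
have hl j : has_deriv J (chen (take j ws) a) z (l j).
  case: j => [|j]; first exact: has_deriv_cst.
  apply: has_deriv_chen => // u; rewrite inE => /orP[/eqP->|/mem_take /mv'].
    by apply: cws; exact: mem_head.
  exact: cws.
have hr j : has_deriv J (chen (rev (drop j ws)) a) z (r j).
  rewrite /r /ws -rcons_cons; case: leqP => js; last first.
    by rewrite drop_oversize ?size_rcons //; exact: has_deriv_cst.
  rewrite drop_rcons // rev_rcons.
  apply: has_deriv_chen => // u; rewrite inE => /orP[/eqP->|].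
    by apply: cws; rewrite inE mem_rcons mem_head orbT.
  by rewrite mem_rev => /mem_drop /mv; exact: cws.
have := @has_deriv_sum R J _ (index_enum 'I_(size ws).+1)
  (fun j y => (-1) ^+ j * (chen (take j ws) a y * chen (rev (drop j ws)) a y))
  (fun j => (-1) ^+ j * (l j * chen (rev (drop j ws)) a z + chen (take j ws) a z * r j)) z
  (fun j => @has_derivZ R J _ ((-1) ^+ j) z _ (has_derivM (hl j) (hr j))).
suff -> : \sum_(j < (size ws).+1) (-1) ^+ j * (l j * chen (rev (drop j ws)) a z +
    chen (take j ws) a z * r j) = 0 by [].
under eq_bigr do rewrite mulrDr; rewrite big_split /=.
rewrite big_ord_recl [X in _ + X]big_ord_recr /= mul0r mulr0 add0r.
have -> : r (size (rcons v w')).+1 = 0 by rewrite /r size_rcons /= ltnn.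
rewrite !mulr0 addr0.
transitivity (- w z * chen_convolution (rcons v w') z +
    w' z * chen_convolution (w :: v) z); last by rewrite IH1 // IH2 // !mulr0 addr0.
rewrite /chen_convolution !mulr_sumr size_rcons; congr (_ + _); apply: eq_bigr => i _.
  by rewrite /bump /= add1n exprS; ring.
rewrite /r -ltnS ltn_ord /ws -rcons_cons -cats1 takel_cat -1?ltnS ?ltn_ord //; ring.
Qed.

End Chen.

(** * Combinations of iterated integrals, jets along a frame, and maximal minors *)

Section ChenSpan.
Variables (R : realType) (I J : set R) (a : R).
Hypotheses (iI : is_interval I) (iJ : is_interval J) (IJ : I `<=` J) (Ja : J a).
Implicit Types (ws : seq (R -> R)).

Definition chen_comb ws (c : nat -> R) (t : R) : R :=
  \sum_(i < (size ws).+1) c i * chen (take i ws) a t.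

Lemma has_deriv_chen_sub w ws t : (forall v, v \in w :: ws -> smooth_on J v) ->
  I t -> has_deriv I (chen (w :: ws) a) t (w t * chen ws a t).
Proof.
move=> sws It; apply: (has_deriv_sub IJ); apply: has_deriv_chen => //; last exact: IJ.
by move=> v /sws; exact: smooth_continuous_rel.
Qed.

Lemma smooth_chen ws : has_two_points I -> (forall w, w \in ws -> smooth_on J w) ->
  smooth_on I (chen ws a).
Proof.
move=> I2; elim: ws => [|w ws IH] sws; first exact: smooth_cst.
apply: (@has_deriv_smooth _ _ iI I2 _ (fun t => w t * chen ws a t)).
  by move=> t It; exact: has_deriv_chen_sub.
apply: smoothM => //; first by apply: (smooth_sub iI I2 IJ); apply: sws; exact: mem_head.
by apply: IH => v vws; apply: sws; rewrite inE vws orbT.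
Qed.

Lemma has_deriv_chen_comb w ws c t : (forall v, v \in w :: ws -> smooth_on J v) ->
  I t -> has_deriv I (chen_comb (w :: ws) c) t (w t * chen_comb ws (c \o S) t).
Proof.
move=> sws It; pose l i := if i is i'.+1 then w t * chen (take i' ws) a t else 0.
have hl i : has_deriv I (chen (take i (w :: ws)) a) t (l i).
  case: i => [|i]; first exact: has_deriv_cst.
  apply: has_deriv_chen_sub => // u; rewrite inE => /orP[/eqP->|/mem_take uws].
    by apply: sws; exact: mem_head.
  by apply: sws; rewrite inE uws orbT.
have := @has_deriv_sum R I _ (index_enum 'I_(size (w :: ws)).+1)
  (fun i y => c i * chen (take i (w :: ws)) a y) (fun i => c i * l i) t
  (fun i => @has_derivZ R I _ (c i) t _ (hl i)).
suff -> : \sum_(i < (size (w :: ws)).+1) c i * l i = w t * chen_comb ws (c \o S) t by [].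
rewrite big_ord_recl /= mulr0 add0r /chen_comb mulr_sumr.
by apply: eq_bigr => i _; rewrite mulrCA.
Qed.

Lemma smooth_chen_comb ws c : has_two_points I -> (forall w, w \in ws -> smooth_on J w) ->
  smooth_on I (chen_comb ws c).
Proof.
move=> I2 sws; apply: smooth_sum => // i; apply: smoothM => //; first exact: smooth_cst.
by apply: smooth_chen => // w /mem_take; exact: sws.
Qed.

(** Induction on the word: if some coefficient other than c 0 is nonzero, the
derivative is a nonvanishing weight times a shorter nontrivial combination, and
[at_most_zeros_Rolle] applies; otherwise the function is a nonzero constant.
The empty word involves no derivative, so there I may be a single point. *)
Lemma chen_comb_zeros ws c : ((0 < size ws)%N -> has_two_points I) ->
  (forall w, w \in ws -> smooth_on J w) ->
  (forall w t, w \in ws -> I t -> w t != 0) ->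
  (exists2 i, (i <= size ws)%N & c i != 0) ->
  at_most_zeros I (size ws) (chen_comb ws c).
Proof.
elim: ws c => [|w ws IH] c I2 sws nzws [i ic ci].
  move: ic ci; rewrite leqn0 => /eqP-> c0.
  apply: at_most_zeros_ext (at_most_zeros_cst c0) => t _.
  by rewrite /chen_comb big_ord_recl big_ord0 /= mulr1 addr0.
have {}I2 := I2 isT.
have tl v : v \in ws -> v \in w :: ws by rewrite inE => ->; rewrite orbT.
have [nz|z] := pselect (exists2 i, (i <= size ws)%N & c i.+1 != 0).
  apply: (at_most_zeros_Rolle iI I2 (f' := fun t => w t * chen_comb ws (c \o S) t)).
  - exact: smooth_chen_comb.
  - by move=> t It; exact: has_deriv_chen_comb.
  apply: at_most_zerosM => //.
  - by apply: (smooth_sub iI I2 IJ); apply: sws; exact: mem_head.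
  - by apply: smooth_chen_comb => // v /tl; exact: sws.
  - by move=> t; apply: nzws; exact: mem_head.
  - by apply: IH => // [v /tl|v t /tl]; [exact: sws|exact: nzws].
have cS j : (j <= size ws)%N -> c j.+1 = 0.
  by move=> js; apply/eqP/negP => cj; apply: z; exists j => //; exact/negP.
have c0 : c 0%N != 0 by case: i ic ci => // i ic; rewrite cS ?eqxx.
have H : at_most_zeros I 0 (chen_comb (w :: ws) c).
  apply: at_most_zeros_ext (at_most_zeros_cst c0) => t _.
  rewrite /chen_comb big_ord_recl /= mulr1 big1 ?addr0 // => j _.
  by rewrite cS ?mul0r // -ltnS.
by move=> s m us sI ms; apply: leq_trans (H s m us sI ms) _.
Qed.

End ChenSpan.

Section Jets.
Variables (R : realType) (A : set R) (v : nat -> R -> R).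
Hypotheses (iA : is_interval A) (A2 : has_two_points A).
Hypothesis sv : forall l, smooth_on A (v l).

(** The coefficient of e_l in the k-th derivative of e_0, for a frame with
e_l' = v_l e_(l+1). *)
Fixpoint jet_coef (k l : nat) : R -> R :=
  if k is k'.+1 then
    fun t => derive_on A (jet_coef k' l) t +
             (if l is l'.+1 then v l' t * jet_coef k' l' t else 0)
  else fun=> (l == 0%N)%:R.

Lemma smooth_jet_coef k l : smooth_on A (jet_coef k l).
Proof.
elim: k l => [|k IH] l; first exact: smooth_cst.
apply: smoothD => //; first exact: smooth_derive.
by case: l => [|l]; [exact: smooth_cst|exact: smoothM].
Qed.

Lemma derive_on_cst f c t : A t -> (forall y, A y -> f y = c) -> derive_on A f t = 0.
Proof.
move=> At fc; apply: has_deriv_unique => //.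
by apply: has_deriv_ext (has_deriv_cst A c t) => // y Ay; rewrite fc.
Qed.

Lemma jet_coef_gt k l t : A t -> (k < l)%N -> jet_coef k l t = 0.
Proof.
elim: k l t => [|k IH] [|l] t At //= kl.
by rewrite (@derive_on_cst _ 0) // ?IH ?mulr0 ?addr0 // => y Ay; apply: IH => //; exact: ltnW.
Qed.

Lemma jet_coefS0 k t : A t -> jet_coef k.+1 0 t = 0.
Proof.
elim: k t => [|k IH] t At; rewrite /= addr0.
  by rewrite (@derive_on_cst _ 1).
by rewrite (@derive_on_cst _ 0).
Qed.

Lemma jet_coef_diag k t : A t -> jet_coef k k t = \prod_(l < k) v l t.
Proof.
elim: k t => [|k IH] t At /=; first by rewrite big_ord0.
rewrite (@derive_on_cst _ 0) // => [|y Ay]; last exact: jet_coef_gt.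
by rewrite add0r IH // big_ord_recr mulrC.
Qed.

Lemma derive_onn_frame (e : nat -> R -> R) k t :
  (forall l t, A t -> has_deriv A (e l) t (v l t * e l.+1 t)) -> A t ->
  derive_onn A k (e 0%N) t = \sum_(l < k.+1) jet_coef k l t * e l t.
Proof.
move=> he; elim: k t => [|k IH] t At.
  by rewrite big_ord_recl big_ord0 /= mul1r addr0.
transitivity (derive_on A (fun y => \sum_(l < k.+1) jet_coef k l y * e l y) t).
  by rewrite /derive_onn iterS; exact: derive_on_ext.
rewrite (@has_deriv_unique _ _ _ _ (\sum_(l < k.+1) (derive_on A (jet_coef k l) t * e l t +
    jet_coef k l t * (v l t * e l.+1 t)))) //; last first.
  apply: (@has_deriv_sum R A _ (index_enum 'I_k.+1) (fun l y => jet_coef k l y * e l y)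
    (fun l => derive_on A (jet_coef k l) t * e l t + jet_coef k l t * (v l t * e l.+1 t))).
  by move=> l; apply: has_derivM; [apply: smooth_has_deriv => //; exact: smooth_jet_coef|exact: he].
rewrite big_split /= [RHS](eq_bigr (fun l : 'I_k.+2 => derive_on A (jet_coef k l) t * e l t +
  (if l : nat is l'.+1 then v l' t * jet_coef k l' t else 0) * e l t)); last first.
  by move=> l _; rewrite mulrDl.
rewrite big_split /= [in RHS]big_ord_recr /= (@derive_on_cst (jet_coef k k.+1) 0) //; last first.
  by move=> y Ay; exact: jet_coef_gt.
rewrite mul0r addr0; congr (_ + _).
by rewrite [RHS]big_ord_recl /= mul0r add0r; apply: eq_bigr => l _; rewrite mulrCA mulrA.
Qed.

End Jets.

Section Minors.
Variables (F : fieldType) (n : nat) (M : 'M[F]_(n.+1, n)).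

(** Expansion of a determinant with a repeated column along that column. *)
Lemma minors_relation k : \sum_(h < n.+1) (-1) ^+ h * \det (row' h M) * M h k = 0.
Proof.
pose X : 'M[F]_(n.+1, 1 + n) := row_mx (col k M) M.
have dX : \det X = 0.
  rewrite -det_tr; apply: (determinant_alternate (i1 := @lshift 1 n 0) (i2 := rshift 1 k)) => //.
  by move=> j; rewrite !mxE (unsplitK (inl _)) (unsplitK (inr _)) mxE.
rewrite -[RHS]dX (expand_det_col X (@lshift 1 n 0)); apply: eq_bigr => h _.
rewrite mulrC; congr (_ * _); first by rewrite mxE (unsplitK (inl _)) mxE.
rewrite /cofactor addn0; congr (_ * \det _).
apply/matrixP => i j; rewrite !mxE.
have -> : lift (@lshift 1 n 0) j = rshift 1 j by apply: val_inj.
by rewrite (unsplitK (inr _)).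
Qed.

(** The difference of two solutions that agree in the coordinate 0 solves the
square system with row 0 removed, which is invertible. *)
Lemma minors_unique (q : 'I_n.+1 -> F) : \det (row' ord0 M) != 0 -> q ord0 = 1 ->
  (forall k, \sum_(h < n.+1) (-1) ^+ h * q h * M h k = 0) ->
  forall h, q h = \det (row' h M) / \det (row' ord0 M).
Proof.
move=> d0 q0 qM.
pose p h := q h - \det (row' h M) / \det (row' ord0 M).
have p0 : p ord0 = 0 by rewrite /p q0 divff ?subrr.
have pM k : \sum_(h < n.+1) (-1) ^+ h * p h * M h k = 0.
  transitivity (\sum_(h < n.+1) (-1) ^+ h * q h * M h k -
    (\sum_(h < n.+1) (-1) ^+ h * \det (row' h M) * M h k) / \det (row' ord0 M)).
    by rewrite mulr_suml -sumrB; apply: eq_bigr => h _; rewrite /p; ring.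
  by rewrite qM minors_relation mul0r subrr.
have M0 : row' ord0 M \in unitmx by rewrite unitmxE unitfE.
pose x : 'rV[F]_n := \row_j ((-1) ^+ lift ord0 j * p (lift ord0 j)).
have x0 : x = 0.
  rewrite -(mulmxK M0 x); suff -> : x *m row' ord0 M = 0 by rewrite mul0mx.
  apply/rowP => k; rewrite !mxE -[RHS](pM k) big_ord_recl p0 mulr0 mul0r add0r.
  by apply: eq_bigr => j _; rewrite !mxE.
move=> h; apply/eqP; rewrite -subr_eq0 -/(p h); apply/eqP.
have [j ->|->//] := unliftP ord0 h.
have /rowP/(_ j)/eqP := x0; rewrite !mxE mulf_eq0 signr_eq0.
by move=> /eqP.
Qed.

End Minors.

(** * Osculating flats as hyperplanes *)

Section Osculating.
Variables (R : realType) (n : nat) (w : n.-tuple (R -> R)) (I J : set R) (a : R).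
Hypotheses (iI : is_interval I) (iJ : is_interval J) (IJ : I `<=` J) (Ja : J a).
Hypothesis sw : forall v, v \in (w : seq (R -> R)) -> smooth_on J v.

(** Entry i of the frame vector e_l: the integral over the letters of index
l + 1 to i of the word. *)
Definition chen_frame (l i : nat) (t : R) : R :=
  if (l <= i)%N then chen (drop l (take i w)) a t else 0.

Lemma has_deriv_chen_frame l i t : (i <= n)%N -> I t ->
  has_deriv I (chen_frame l i) t (nth (fun=> 0) w l t * chen_frame l.+1 i t).
Proof.
move=> i_n It; rewrite /chen_frame; case: (ltngtP l i) => li; last 2 first.
- by rewrite mulr0; exact: has_deriv_cst.
- rewrite mulr0 li drop_oversize; first exact: has_deriv_cst.
  by rewrite size_take size_tuple; case: ifP => // /negbT; rewrite -leqNgt.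
have lt : (l < size (take i w))%N by rewrite size_takel // size_tuple.
rewrite (drop_nth (fun=> 0) lt) nth_take //.
apply: (has_deriv_chen_sub iJ IJ Ja) => // v; rewrite -(nth_take (fun=> 0) li).
by rewrite -drop_nth // => /mem_drop /mem_take; exact: sw.
Qed.

Lemma chen_frame_diag i t : (i <= n)%N -> chen_frame i i t = 1.
Proof.
by move=> i_n; rewrite /chen_frame leqnn drop_oversize // size_takel // size_tuple.
Qed.

Lemma chen_frame_gt l i t : (i < l)%N -> chen_frame l i t = 0.
Proof. by rewrite /chen_frame ltnNge; case: ifP. Qed.

Lemma chen_frame0 i t : chen_frame 0 i t = chen (take i w) a t.
Proof. by rewrite /chen_frame drop0. Qed.

(** The form whose kernel is the osculating hyperplane at t, in the coordinates
(1, p) of the affine chart. *)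
Definition osc_form (q : 'I_n.+1 -> R) (t : R) : R :=
  \sum_(j < n.+1) (-1) ^+ j * q j * dual_chen w a j t.

Lemma osc_form_sum (K : finType) (c : K -> R) (q : K -> 'I_n.+1 -> R) t :
  osc_form (fun j => \sum_k c k * q k j) t = \sum_k c k * osc_form (q k) t.
Proof.
rewrite /osc_form; under [RHS]eq_bigr do rewrite mulr_sumr.
rewrite exchange_big /=; apply: eq_bigr => j _.
by rewrite mulr_sumr mulr_suml; apply: eq_bigr => k _; ring.
Qed.

(** The entries below l vanish, and after the shift j = l + i the sum is, up to
sign, the convolution identity of the nonempty tail of the word after its
first l letters. *)
Lemma osc_form_frame (l : nat) t : (l < n)%N -> J t ->
  osc_form (fun j => chen_frame l j t) t = 0.
Proof.
move=> ln Jt; pose F j := (-1) ^+ j * chen_frame l j t * chen (rev (drop j w)) a t.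
rewrite /osc_form -(big_mkord xpredT F) (big_cat_nat (n := l)) //=; last exact: leqW (ltnW ln).
rewrite big_nat big1 ?add0r => [|j /andP[_ jl]]; last by rewrite /F chen_frame_gt // mulr0 mul0r.
rewrite -{1}[l]add0n big_addn subSn ?(ltnW ln) // big_mkord.
transitivity ((-1) ^+ l * chen_convolution a (drop l w) t); last first.
  rewrite (chen_convolution0 iJ Ja) ?mulr0 //; last by rewrite size_drop size_tuple subn_gt0.
  by move=> v /mem_drop /sw; exact: smooth_continuous_rel.
rewrite /chen_convolution mulr_sumr size_drop size_tuple; apply: eq_bigr => i _.
rewrite /F /chen_frame leq_addl drop_drop take_drop exprD; ring.
Qed.

Lemma osc_form_frame_last t : osc_form (fun j => chen_frame n j t) t = (-1) ^+ n.
Proof.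
rewrite /osc_form big_ord_recr /= big1 => [|j _]; last first.
  by rewrite chen_frame_gt ?mulr0 ?mul0r //= ltn_ord.
rewrite add0r chen_frame_diag // mulr1 /dual_chen drop_oversize ?size_tuple //=.
by rewrite mulr1.
Qed.

Definition affine_coord (p : 'cV[R]_n) (j : 'I_n.+1) : R :=
  if unlift ord0 j is Some i then p i ord0 else 1.

Lemma affine_coord0 p : affine_coord p ord0 = 1.
Proof. by rewrite /affine_coord unlift_none. Qed.

Lemma affine_coordS p i : affine_coord p (lift ord0 i) = p i ord0.
Proof. by rewrite /affine_coord liftK. Qed.

Lemma frame_decomposition (q : 'I_n.+1 -> R) t : exists c : 'I_n.+1 -> R,
  forall j, q j = \sum_l c l * chen_frame l j t.
Proof.
pose E : 'M[R]_n.+1 := \matrix_(l, j) chen_frame l j t.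
have EU : E \in unitmx.
  rewrite -unitmx_tr unitmxE det_trig.
    rewrite big1 ?unitr1 // => i _; rewrite !mxE chen_frame_diag //.
    by rewrite -ltnS.
  by apply/is_trig_mxP => i j ij; rewrite !mxE chen_frame_gt.
exists (fun l => ((\row_j q j) *m invmx E) ord0 l) => j.
have := mulmxKV EU (\row_j q j) => /rowP/(_ j); rewrite !mxE => <-.
by apply: eq_bigr => l _; rewrite [E l j]mxE.
Qed.

End Osculating.

Section OsculatingHyperplane.
Variables (R : realType) (m : nat) (w : m.+1.-tuple (R -> R)) (I J : set R) (a : R).
Hypotheses (iI : is_interval I) (iJ : is_interval J) (IJ : I `<=` J) (Ja : J a).
Hypothesis sw : forall v, v \in (w : seq (R -> R)) -> smooth_on J v.
Hypothesis nzw : forall v t, v \in (w : seq (R -> R)) -> I t -> v t != 0.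
Hypothesis I2 : (0 < m)%N -> has_two_points I.

(** The matrix of jet coefficients is lower triangular, with the products of the
first k nonvanishing weights on its diagonal. The column l = 0 is left out:
no derivative of positive order has a component along e_0. *)
Lemma jets_of_curve t : I t -> exists2 B : 'M[R]_m, B \in unitmx &
  forall (k : 'I_m) (i : 'I_m.+1), curve_deriv I (chen_curve w a) k.+1 t i ord0 =
    \sum_(l < m) B k l * chen_frame w a l.+1 i.+1 t.
Proof.
move=> It; have [m0|/I2 I2'] := posnP m.
  exists 1%:M; first exact: unitmx1.
  by move=> k; have := ltn_ord k; rewrite [X in (_ < X)%N]m0.
pose v l := nth (fun=> 0) w l : R -> R.
have sv l : smooth_on I (v l).
  have [ln|nl] := ltnP l (size w).
    by apply: (smooth_sub iI I2' IJ); apply: sw; exact: mem_nth.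
  by rewrite /v nth_default //; exact: smooth_cst.
exists (\matrix_(k, l) jet_coef I v k.+1 l.+1 t).
  rewrite unitmxE det_trig ?unitfE; last first.
    by apply/is_trig_mxP => i j ij; rewrite mxE jet_coef_gt.
  apply/prodf_neq0 => i _; rewrite mxE jet_coef_diag //.
  apply/prodf_neq0 => l _; apply: nzw => //; apply: mem_nth.
  by rewrite size_tuple (leq_trans (ltn_ord l)) // ltnW // ltnS ltn_ord.
move=> k i; rewrite mxE.
rewrite (@derive_onn_ext _ _ _ _ (chen_frame w a 0 i.+1)) //; last first.
  by move=> y _; rewrite mxE chen_frame0.
rewrite (derive_onn_frame iI I2' sv (e := fun l => chen_frame w a l i.+1)) //; last first.
  by move=> l y Iy; apply: (has_deriv_chen_frame iJ IJ Ja sw).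
rewrite big_ord_recl jet_coefS0 // mul0r add0r.
rewrite (big_ord_widen m (fun l => jet_coef I v k.+1 l.+1 t * chen_frame w a l.+1 i.+1 t)) //.
rewrite big_mkcond; apply: eq_bigr => l _; rewrite mxE.
by case: ltnP => // kl; rewrite jet_coef_gt ?mul0r.
Qed.

(** The flat is e_0 + span(e_1, .., e_m), as the jets and these frame vectors
generate the same space. Writing (1, p) in the frame, its coefficient along
e_0 is 1, and the form reads off the coefficient along e_(m+1) up to sign. *)
Lemma osc_hyperplane t p : I t ->
  osc I (chen_curve w a) m t p <-> osc_form w a (affine_coord p) t = 0.
Proof.
move=> It; have [B BU jets] := jets_of_curve It.
have Jt := IJ It.
pose q0 : 'I_m.+2 -> R := fun j => chen_frame w a 0 j t.
have q0E (j : 'I_m.+2) : affine_coord (chen_curve w a t) j = q0 j.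
  rewrite /q0 chen_frame0; have [i ->|->] := unliftP ord0 j.
    by rewrite affine_coordS mxE.
  by rewrite affine_coord0 take0.
have oscP : osc I (chen_curve w a) m t p <-> exists c : 'I_m -> R,
    forall j, affine_coord p j = q0 j + \sum_(l < m) c l * chen_frame w a l.+1 j t.
  split=> [[al pE]|[c pE]].
    exists (fun l => \sum_(k < m) al k * B k l) => j.
    rewrite -q0E; have [i ->|->] := unliftP ord0 j; last first.
      by rewrite !affine_coord0 big1 ?addr0 // => l _; rewrite mulr0.
    rewrite !affine_coordS pE [LHS]mxE summxE; congr (_ + _).
    under [RHS]eq_bigr do rewrite mulr_suml.
    rewrite exchange_big /=; apply: eq_bigr => k _; rewrite mxE jets mulr_sumr.
    by apply: eq_bigr => l _; rewrite mulrA.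
  pose al := (\row_l c l) *m invmx B.
  have alB l : c l = \sum_(k < m) al ord0 k * B k l.
    have := mulmxKV BU (\row_l c l) => /rowP/(_ l).
    by rewrite mxE [in RHS]mxE => <-.
  exists (fun k => al ord0 k); apply/colP => i.
  rewrite -affine_coordS pE -q0E affine_coordS [RHS]mxE summxE; congr (_ + _).
  under eq_bigr do rewrite alB mulr_suml.
  rewrite exchange_big /=; apply: eq_bigr => k _; rewrite [RHS]mxE jets mulr_sumr.
  by apply: eq_bigr => l _; rewrite mulrA.
rewrite oscP; split=> [[c pE]|pE].
  pose c' (l : 'I_m.+1) := if unlift ord0 l is Some l' then c l' else 1.
  have -> : affine_coord p = fun j => \sum_(l < m.+1) c' l * chen_frame w a l j t.
    apply/funext => j; rewrite pE big_ord_recl /c' unlift_none mul1r; congr (_ + _).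
    by apply: eq_bigr => l _; rewrite liftK.
  rewrite osc_form_sum big1 // => l _.
  by rewrite (osc_form_frame iJ Ja sw) ?mulr0.
have [c cE] := frame_decomposition w a (affine_coord p) t.
have c0 : c ord0 = 1.
  rewrite -(affine_coord0 p) cE big_ord_recl chen_frame_diag // mulr1 big1 ?addr0 // => l _.
  by rewrite chen_frame_gt ?mulr0.
have cn : c ord_max = 0.
  move: pE; have -> : affine_coord p = fun j => \sum_l c l * chen_frame w a l j t.
    by apply/funext.
  rewrite osc_form_sum big_ord_recr /= osc_form_frame_last big1 => [|l _]; last first.
    by rewrite (osc_form_frame iJ Ja sw) ?mulr0 /=.
  by rewrite add0r => /eqP; rewrite mulf_eq0 signr_eq0 orbF => /eqP.
exists (fun l => c (lift ord0 (widen_ord (leqnSn m) l))) => j.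
rewrite cE big_ord_recl c0 mul1r big_ord_recr /=.
have -> : lift ord0 (@ord_max m) = ord_max by apply: val_inj.
by rewrite cn mul0r addr0.
Qed.

End OsculatingHyperplane.

(** * The Chebyshev property and the blossom *)

Lemma has_two_points_injective (R : realType) (I : set R) m (u : 'I_m.+1 -> R) :
  injective u -> (forall k, I (u k)) -> (0 < m)%N -> has_two_points I.
Proof.
move=> uI Iu m0; have : u ord0 != u ord_max.
  by apply/eqP => /uI /(congr1 val) /= m0'; rewrite -m0' in m0.
by rewrite neq_lt => /orP[lt|lt]; [exists (u ord0), (u ord_max)|exists (u ord_max), (u ord0)].
Qed.

Section Blossom.
Variables (R : realType) (m : nat) (w : m.+1.-tuple (R -> R)) (I J : set R) (a : R).
Hypotheses (iI : is_interval I) (iJ : is_interval J) (IJ : I `<=` J) (Ja : J a).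
Hypothesis sw : forall v, v \in (w : seq (R -> R)) -> smooth_on J v.
Hypothesis nzw : forall v t, v \in (w : seq (R -> R)) -> I t -> v t != 0.

(** If the determinant were zero, a nontrivial combination of 1, L_(w_n), ..,
L_(w_n .. w_2) would vanish at the n points u_k, one more than
[chen_comb_zeros] allows. *)
Lemma dual_det0_neq0 (u : 'I_m.+1 -> R) : injective u -> (forall k, I (u k)) ->
  dual_det w a ord0 u != 0.
Proof.
move=> uI Iu; apply/det0P => -[x x0 xM].
pose ws := rev (behead w).
have sws : size ws = m by rewrite size_rev size_behead size_tuple.
have wsw v : v \in ws -> v \in (w : seq _) by rewrite mem_rev => /mem_behead.
(* rows are indexed by decreasing word length, combinations by increasing length *)
pose c (i : nat) := x ord0 (inord (m - i)).
have dE (j : 'I_m.+1) : dual_chen w a (lift ord0 j) = chen (take (m - j) ws) a.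
  have -> : take (m - j) ws = rev (drop j (behead w)).
    by rewrite rev_drop size_behead size_tuple.
  by rewrite /dual_chen -drop1 drop_drop addn1.
have cu k : chen_comb a ws c (u k) = 0.
  have /rowP/(_ k) := xM; rewrite !mxE => xk; rewrite -[RHS]xk /chen_comb sws.
  rewrite (reindex_inj rev_ord_inj); apply: eq_bigr => j _.
  have jm : (j <= m)%N by rewrite -ltnS.
  by rewrite mxE dE /= subSS /c subKn // inord_val.
have cnz : exists2 i, (i <= size ws)%N & c i != 0.
  have [j xj] : exists j, x ord0 j != 0 by exact/rV0Pn.
  exists (m - j)%N; first by rewrite sws leq_subr.
  by rewrite /c subKn ?inord_val // -ltnS.
have ws2 : (0 < size ws)%N -> has_two_points I.
  by rewrite sws; exact: has_two_points_injective uI Iu.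
have H := chen_comb_zeros iI iJ IJ Ja ws2 (fun v vws => sw (wsw v vws))
  (fun v t vws It => nzw (wsw v vws) It) cnz.
suff : (\sum_(z <- codom u) 1 <= size ws)%N.
  by rewrite sum1_size size_codom card_ord sws ltnn.
apply: H; first exact/injectiveP.
  by move=> z /codomP[k ->].
by move=> z [|k] // /codomP[k ->] _; exact: cu.
Qed.

Lemma dual_det_row' h (u : 'I_m.+1 -> R) :
  dual_det w a h u = \det (row' h (\matrix_(j, k) dual_chen w a j (u k))).
Proof. by congr (\det _); apply/matrixP => i j; rewrite !mxE. Qed.

(** The derivatives of the coordinates are w_1 times the integrals for the word
w_2 .. w_n and its prefixes, so [chen_comb_zeros] bounds their zeros. *)
Lemma chen_curve_chebyshev : has_two_points I -> chebyshev_function I (chen_curve w a).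
Proof.
move=> I2; pose w0 := nth (fun=> 0) w 0; pose ws := behead w.
have wE : (w : seq _) = w0 :: ws by rewrite /w0 /ws; case: (w) => -[].
have sws : size ws = m by rewrite size_behead size_tuple.
have w0w : w0 \in (w : seq _) by rewrite wE mem_head.
have wsw v : v \in ws -> v \in (w : seq _) by rewrite wE inE => ->; rewrite orbT.
have phiE (i : 'I_m.+1) t : chen (take i.+1 w) a t = chen_curve w a t i ord0 by rewrite mxE.
have dphi (i : 'I_m.+1) t : I t ->
    derive_on I (fun t => chen_curve w a t i ord0) t = w0 t * chen (take i ws) a t.
  move=> It; apply: has_deriv_unique => //.
  apply: (has_deriv_ext (f := chen (take i.+1 w) a)) => //.
  rewrite wE /=; apply: (has_deriv_chen_sub iJ IJ Ja) => // v.
  by rewrite inE => /orP[/eqP->|/mem_take /wsw]; exact: sw.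
pose f (c : 'I_m.+1 -> R) t :=
  \sum_(i < m.+1) c i * derive_on I (fun t => chen_curve w a t i ord0) t.
have fE c t : I t -> f c t = w0 t * chen_comb a ws (fun i => c (inord i)) t.
  move=> It; rewrite /f /chen_comb sws mulr_sumr; apply: eq_bigr => i _.
  by rewrite dphi // inord_val mulrCA.
have fz c i : c i != 0 -> at_most_zeros I m (f c).
  move=> ci.
  apply: (at_most_zeros_ext (f := fun t => w0 t * chen_comb a ws (fun i => c (inord i)) t)).
    by move=> t It; rewrite fE.
  apply: at_most_zerosM => //.
  - by apply: (smooth_sub iI I2 IJ); exact: sw.
  - exact: (smooth_chen_comb iI iJ IJ Ja I2 (fun v vws => sw (wsw v vws))).
  - by move=> t; exact: nzw.
  rewrite -[X in at_most_zeros _ X _]sws; apply: (chen_comb_zeros iI iJ IJ Ja) => //.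
  - by move=> v /wsw; exact: sw.
  - by move=> v t /wsw; exact: nzw.
  by exists i; rewrite ?inord_val // sws -ltnS.
split; [|split].
- move=> i; apply: (smooth_ext (f := chen (take i.+1 w) a)) => //.
  exact: (smooth_chen iI iJ IJ Ja I2 (fun v vws => sw (mem_take vws))).
- move=> c c0 i; apply/eqP/negPn/negP => /fz.
  (* linear independence: the zero function has a zero of multiplicity m + 1 *)
  have [x [_ [Ix _ _]]] := I2.
  move=> /(_ [:: x] (fun=> m.+1)); rewrite big_seq1 ltnn => F.
  suff : false by []; apply: F => //.
    by move=> y; rewrite inE => /eqP->.
  move=> y k; rewrite inE => /eqP-> _; rewrite -[RHS](derive_onn0 iI I2 k Ix).
  exact: derive_onn_ext.
move=> c [t [It ft]]; have [i ci] : exists i, c i != 0.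
  apply: contrapT => nc; move/eqP: ft; apply; apply: big1 => i _.
  have [->|ci] := eqVneq (c i) 0; first by rewrite mul0r.
  by case: nc; exists i.
exact: fz ci.
Qed.

End Blossom.

Theorem theorem2 (R : realType) (n : nat) (I J : set R)
    (w : n.-tuple (R -> R)) (a : R)
    (hn : (1 <= n)%N)
    (hI : is_interval I) (hI0 : I !=set0)
    (hJ : is_interval J) (hIJ : I `<=` J)
    (hsmooth : forall i : 'I_n, smooth_on J (tnth w i))
    (hnz : forall (i : 'I_n) (t : R), I t -> tnth w i t != 0)
    (ha : J a) :
  (has_two_points I -> chebyshev_function I (chen_curve w a)) /\
  (forall u : 'I_n -> R, injective u -> (forall k, I (u k)) ->
     dual_det w a ord0 u != 0 /\
     is_blossom_value I (chen_curve w a) u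
       (\col_(i < n) (dual_det w a (lift ord0 i) u / dual_det w a ord0 u))).
Proof.
case: n hn => // m _ in w hsmooth hnz *.
have sw v : v \in (w : seq (R -> R)) -> smooth_on J v.
  by move=> /tnthP[i ->].
have nzw v t : v \in (w : seq (R -> R)) -> I t -> v t != 0.
  by move=> /tnthP[i ->]; exact: hnz.
split; first exact: (chen_curve_chebyshev hI hJ hIJ ha sw nzw).
move=> u uI Iu; have d0 := dual_det0_neq0 hI hJ hIJ ha sw nzw uI Iu.
split=> //; rewrite /is_blossom_value /=.
have I2 := has_two_points_injective uI Iu.
have oscE k p := osc_hyperplane hI hJ hIJ ha sw nzw I2 p (Iu k).
pose M := \matrix_(j < m.+2, k < m.+1) dual_chen w a j (u k).
have formE q k : osc_form w a q (u k) = \sum_(h < m.+2) (-1) ^+ h * q h * M h k.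
  by apply: eq_bigr => h _; rewrite mxE.
rewrite eqEsubset; split=> p /=.
  move=> pu; apply/colP => i; rewrite mxE !dual_det_row' -affine_coordS.
  apply: minors_unique; first by rewrite -dual_det_row'.
    exact: affine_coord0.
  by move=> k; rewrite -formE; apply/oscE; exact: pu.
move=> -> k _; apply/oscE; rewrite formE.
transitivity ((\sum_(h < m.+2) (-1) ^+ h * \det (row' h M) * M h k) / dual_det w a ord0 u).
  rewrite mulr_suml; apply: eq_bigr => h _; rewrite -dual_det_row'.
  have [i ->|->] := unliftP ord0 h; first by rewrite affine_coordS mxE; ring.
  by rewrite affine_coord0 mulr1 [X in X / _]mulrAC mulfK.
by rewrite minors_relation mul0r.
Qed.
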